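(* Let $X$ and $A$ be nonempty sets and let $F\colon A\to\mathcal P(X)$ be a soft set with $F(t)\neq\varnothing$ for every $t\in A$ and $\mathrm{SE}(F)\neq\varnothing$. Let $\tau$ be a soft topology on $F$. Then the family $$\mathcal B_\tau=\{\mathrm{SE}(H):H\in\tau\}$$ is a basis for a topology on the set $\mathrm{SE}(F)$. Denoting the generated topology by $\tau^{\mathrm e}$, one has $$\tau^{\mathrm e}=\Bigl\{\bigcup_{H\in\mathcal H}\mathrm{SE}(H):\mathcal H\subseteq\tau\Bigr\}.$$
   Context: A soft set over $X$ with parameter set $A$ is a map $H\colon A\to\mathcal P(X)$. For soft sets $H,K$ with parameter set $A$: $H\subseteq_s K$ means $H(t)\subseteq K(t)$ for every $t\in A$ (then $H$ is a soft subset of $K$). Soft unions (arbitrary) and soft intersections (finite) are taken pointwise, i.e. $(H\cup_s K)(t)=H(t)\cup K(t)$ and $(H\cap_s K)(t)=H(t)\cap K(t)$. The null soft set $\Phi$ is $\Phi(t)=\varnothing$ for all $t\in A$. A soft element of $F$ is a map $a\colon A\to X$ with $a(t)\in F(t)$ for every $t\in A$; $\mathrm{SE}(F)$ is the set of all soft elements of $F$. For $H\subseteq_s F$, $\mathrm{SE}(H)=\{a\in\mathrm{SE}(F):a(t)\in H(t)\text{ for every }t\in A\}$. A soft topology on $F$ is a family $\tau$ of soft subsets of $F$ with $\Phi,F\in\tau$, closed under arbitrary soft unions and finite soft intersections. *)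

(* Defs.v *)
From HB Require Import structures.
From mathcomp Require Import all_boot.
From mathcomp Require Import boolp classical_sets functions filter topology.

Set Implicit Arguments.
Unset Strict Implicit.
Unset Printing Implicit Defensive.

Local Open Scope classical_set_scope.

Section SoftSets.
Context {X A : Type}.

Definition soft_set : Type := A -> set X.

Implicit Types (F H K : soft_set) (G tau : set soft_set).

Definition soft_subset H K : Prop := forall t, H t `<=` K t.

Definition soft_null : soft_set := fun _ => set0.

Definition soft_setI H K : soft_set := fun t => H t `&` K t.

Definition soft_bigcup G : soft_set := fun t => \bigcup_(H in G) H t.

(* Binary intersections together with F itself (the empty intersection among
   soft subsets of F) give all finite soft intersections. *)
Record is_soft_topology F tau : Prop := IsSoftTopology {
  soft_topology_sub : forall H, tau H -> soft_subset H F;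
  soft_topology_null : tau soft_null;
  soft_topology_full : tau F;
  soft_topology_bigcup : forall G, G `<=` tau -> tau (soft_bigcup G);
  soft_topology_setI : forall H K, tau H -> tau K -> tau (soft_setI H K)
}.

Definition soft_elements F : set (A -> X) := [set a | forall t, F t (a t)].

(* For H a soft subset of F, SE F H is SE(H) seen as a subset of the set SE(F),
   the latter being the carrier type [soft_elements F] (via [set_type]). *)
Definition SE F H : set (soft_elements F) :=
  [set a | forall t, H t (val a t)].

Definition soft_basis F tau : set (set (soft_elements F)) :=
  [set SE H | H in tau].

End SoftSets.

Arguments soft_set : clear implicits.
Arguments SE {X A} F H.
Arguments soft_basis {X A} F tau.

(* The usual conditions for a family of subsets of T to be a basis for some
   topology on T, no topology on T being given. *)
Definition is_topology_basis {T : Type} (B : set (set T)) : Prop :=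
  (forall x : T, exists2 U, B U & U x) /\
  (forall U V, B U -> B V -> forall x, (U `&` V) x ->
     exists W, [/\ B W, W x & W `<=` U `&` V]).

(* A copy of T, with the coarsest topology making all members of B open. *)
Definition generated_topology {T : Type} (B : set (set T)) : Type := T.

HB.instance Definition _ (T : Type) (B : set (set T)) :=
  gen_eqMixin (generated_topology B).
HB.instance Definition _ (T : Type) (B : set (set T)) :=
  gen_choiceMixin (generated_topology B).
HB.instance Definition _ (T : Type) (B : set (set T)) :=
  @isSubBaseTopological.Build (generated_topology B)
    (set (generated_topology B)) B id.

(* Main.v *)
Require Import Defs.
From mathcomp Require Import all_boot.
From mathcomp Require Import boolp classical_sets functions filter topology.

Local Open Scope classical_set_scope.

(** Membership in [SE F H] is tested separately at each parameter, so [SE] turns soft intersections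
    into intersections, and [SE F F] is the whole carrier. Hence the sets [SE F H] cover and are
    stable under binary intersection ([soft_basisP]). For any such basis the generated open sets are
    the unions of its members ([open_generated_topology]); pulling a subfamily of the basis back
    along [SE] indexes the union by soft sets in [tau]. *)

Section GeneratedTopology.
Context {T : Type} {B : set (set T)}.
Hypothesis B_basis : is_topology_basis B.

(** Induction on the finite intersection: the covering condition handles the empty one, and the
    second basis condition refines two members found around [x] to a single one. *)
Lemma basis_sub_finI_from (W : set T) (x : T) :
  finI_from B id W -> W x -> exists V, [/\ B V, V x & V `<=` W].
Proof.
move=> [D DB <-]; rewrite bigcap_fset big_seq.
elim/big_ind: _ x => [x _|V W' IHV IHW x [Vx W'x]|V /DB /set_mem BV x Vx].
- by have [V BV Vx] := B_basis.1 x; exists V.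
- have [V1 [BV1 V1x V1V]] := IHV x Vx.
  have [V2 [BV2 V2x V2W]] := IHW x W'x.
  have [V3 [BV3 V3x V3I]] := B_basis.2 V1 V2 BV1 BV2 x (conj V1x V2x).
  by exists V3; split=> // y /V3I[/V1V Vy /V2W W'y].
- by exists V; split=> //; exact: subset_refl.
Qed.

(* The library builds the open sets of [isSubBaseTopological] as the unions of
   members of [finI_from B id], which is what unfolds on both sides below. *)
Lemma open_generated_topology (U : set (generated_topology B)) :
  open U <-> exists2 G : set (set T), G `<=` B & U = \bigcup_(V in G) V.
Proof.
split=> [[D DB <-]|[G GB ->]]; last first.
  by exists G => // V /GB; exact: (@finI_from1 _ _ B id V).
(* Taking every basis member that lies inside some [W] in [D] avoids choosing one for each point. *)
exists [set V | B V /\ exists2 W, D W & V `<=` W]; first by move=> V [].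
apply/seteqP; split=> [x [W DW Wx]|x [V [_ [W DW VW]] Vx]].
  have [V [BV Vx VW]] := @basis_sub_finI_from W x (DB W DW) Wx.
  by exists V => //; split=> //; exists W.
by exists W => //; exact: VW.
Qed.

Lemma basis_generated_topology : @basis (generated_topology B) B.
Proof.
split=> [V BV|x U].
  apply/open_generated_topology; exists [set V]; first by move=> _ ->.
  by rewrite bigcup_set1.
rewrite nbhsE => -[O [/open_generated_topology[G GB ->] [V GV Vx]] OU].
exists V; first by split=> //; exact: GB.
by apply: subset_trans OU => y Vy; exists V.
Qed.

End GeneratedTopology.

Lemma soft_basisP (X A : Type) (F : soft_set X A) (tau : set (soft_set X A)) :
  is_soft_topology F tau -> is_topology_basis (soft_basis F tau).
Proof.
move=> tauP; split=> [x|_ _ [H tauH <-] [K tauK <-] x [Hx Kx]].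
  exists (SE F F); first by exists F => //; exact: soft_topology_full tauP.
  by move=> t; exact: (set_valP x t).
(* The refining member is the full intersection, so it does not depend on [x]. *)
exists (SE F (soft_setI H K)); split; last first.
- by move=> y HKy; split=> t; have [] := HKy t.
- by move=> t; split; [exact: Hx|exact: Kx].
- by exists (soft_setI H K) => //; exact: soft_topology_setI tauP _ _ _ _.
Qed.

Theorem theorem3p3 (X A : Type) (hX : [set: X] !=set0) (hA : [set: A] !=set0)
    (F : soft_set X A) (hF : forall t : A, F t !=set0)
    (hSE : soft_elements F !=set0)
    (tau : set (soft_set X A)) (htau : is_soft_topology F tau) :
  let B : set (set (soft_elements F)) := soft_basis F tau in
  [/\ is_topology_basis B,
      @basis (generated_topology B) B &
      @open (generated_topology B) =
        [set U | exists2 G : set (soft_set X A), G `<=` tau &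
                   U = \bigcup_(H in G) SE F H]].
Proof.
move=> B; have B_basis : is_topology_basis B by exact: soft_basisP.
split=> //; first exact: basis_generated_topology.
apply/seteqP; split=> U.
  move=> /(open_generated_topology B_basis)[D DB ->].
  (* The full preimage of [D] under [SE] within [tau]: distinct [H] may yield the same set, which
     does not change the union. *)
  exists [set H | tau H /\ D (SE F H)]; first by move=> H [].
  apply/seteqP; split=> [x [V DV Vx]|x [H [_ DH] Hx]]; last by exists (SE F H).
  have [H tauH HV] := DB V DV.
  by exists H; rewrite /= HV.
move=> [G Gtau ->]; apply/(open_generated_topology B_basis).
exists [set SE F H | H in G]; last by rewrite bigcup_image.
by move=> _ [H GH <-]; exists H => //; exact: Gtau.
Qed.
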